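(* Let $n\geq 1$, $v\geq 2$ and $0\leq\Delta<v$ be integers. Then for every integer $L\geq 0$, \[ G\!\left(L-\Delta 2^{n-1},\,L+\Delta 2^{n-1},\,2\tfrac{2^n-2^{-n}}{3}(v+\Delta)+2^{-n},\,2\tfrac{2^n-2^{-n}}{3}(v-\Delta)+2^{-n},\,2^nv,\,q\right)\geq 0, \] i.e. this polynomial in $q$ has nonnegative coefficients.
   Context: For integers $n\ge0$, $(q)_n=\prod_{j=1}^{n}(1-q^j)$; for integers $m,n$, ${n+m \brack n}_q=\frac{(q)_{n+m}}{(q)_n(q)_m}$ if $m,n\geq 0$ and $0$ otherwise. For integers $N,M$, real $\alpha,\beta$ and positive integer $K$ (with the exponents below integers), $G(N,M,\alpha,\beta,K,q)=\sum_{j=-\infty}^{\infty}(-1)^jq^{Kj\frac{(\alpha+\beta)j+(\alpha-\beta)}{2}}{N+M \brack N-Kj}_q$. For a polynomial $P(q)$, $P(q)\geq 0$ means all its coefficients are nonnegative. *)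

(* Defs.v *)
From HB Require Import structures.
From mathcomp Require Import all_boot all_order all_algebra.
From mathcomp Require Import fraction.
From mathcomp Require Import all_classical reals.
From mathcomp Require Import zify ring lra.

Set Implicit Arguments.
Unset Strict Implicit.
Unset Printing Implicit Defensive.
Import Order.TTheory GRing.Theory Num.Theory.
Local Open Scope ring_scope.

(* Everything is computed in the field Z(q), so that quotients of              *)
(* q-factorials and integer powers of q are literal.                           *)
Notation Zq := {fraction {poly int}}.

Definition q : Zq := FracField.tofrac ('X : {poly int}).

Definition qfact (n : nat) : Zq := \prod_(1 <= j < n.+1) (1 - q ^+ j).

(* qbinom t b is [t choose b]_q; the case m, n >= 0 of [n + m choose n]_q      *)
(* is 0 <= b and 0 <= t - b.                                                   *)
Definition qbinom (t b : int) : Zq :=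
  if (0 <= b) && (0 <= t - b)
  then qfact `|t|%N / (qfact `|b|%N * qfact `|t - b|%N)
  else 0.

Definition Gexp (R : realType) (alpha beta : R) (K : nat) (j : int) : R :=
  K%:R * j%:~R * (((alpha + beta) * j%:~R + (alpha - beta)) / 2).

(* The floor only turns the exponent, which G assumes to be an integer, into   *)
(* an element of int. The sum over all j in Z is a sum over the support of its *)
(* summand, which is finite for K > 0 (G_finite_support).                      *)
Definition Gterm (R : realType) (N M : int) (alpha beta : R) (K : nat)
    (j : int) : Zq :=
  (-1) ^ j * q ^ (Num.floor (Gexp alpha beta K j)) * qbinom (N + M) (N - K%:Z * j).

Definition G (R : realType) (N M : int) (alpha beta : R) (K : nat) : Zq :=
  \sum_(j \in [set: int]) Gterm N M alpha beta K j.

Definition nonneg_coefs (f : Zq) : Prop :=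
  exists2 p : {poly int}, f = FracField.tofrac p & forall i : nat, 0 <= p`_i.

Lemma G_finite_support (R : realType) (N M : int) (alpha beta : R) (K : nat) :
  (0 < K)%N ->
  finite_set ([set: int] `&` Gterm N M alpha beta K @^-1` [set~ 0])%classic.
Proof.
move=> K0; set B := (`|N| + `|M|)%N.
apply: (@sub_finite_set _ _
  ((fun i : nat => i%:Z - B%:Z) @` [set i | (i < (B + B).+1)%N])%classic).
  move=> j [_ /= nz]; rewrite /Gterm /qbinom in nz.
  case: ifP nz => [/andP[h1 h2] _|_]; last by rewrite mulr0.
  exists (absz (j + B%:Z)) => /=; rewrite /B; nia.
by apply: finite_image; exact: finite_II.
Qed.

(* With alpha and beta as in the theorem, all exponents in G are integers.     *)
Lemma Gexp_int (R : realType) (n v D : nat) (j : int) :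
  Gexp (2 * ((2 ^+ n - 2 ^- n) / 3) * (v%:R + D%:R) + 2 ^- n : R)
       (2 * ((2 ^+ n - 2 ^- n) / 3) * (v%:R - D%:R) + 2 ^- n : R)
       (2 ^ n * v) j \is a Num.int.
Proof.
have [k kE] : exists k : nat, (4 ^ n = 3 * k + 1)%N.
  elim: n => [|n [k IH]]; first by exists 0%N.
  by exists (4 * k + 1)%N; rewrite expnS IH; lia.
have : (2 ^+ n * 2 ^+ n : R) = 3 * k%:R + 1.
  by rewrite -exprMn (_ : 2 * 2 = 4%:R) -?natrM // -natrX kE natrD natrM.
have : (2 ^+ n : R) != 0 by rewrite expf_neq0 // pnatr_eq0.
rewrite /Gexp natrM natrX; set t := 2 ^+ n => t0 tE.
have -> : t * v%:R * j%:~R *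
    (((2 * ((t - t^-1) / 3) * (v%:R + D%:R) + t^-1 +
       (2 * ((t - t^-1) / 3) * (v%:R - D%:R) + t^-1)) * j%:~R +
      (2 * ((t - t^-1) / 3) * (v%:R + D%:R) + t^-1 -
       (2 * ((t - t^-1) / 3) * (v%:R - D%:R) + t^-1))) / 2) =
  v%:R * j%:~R * ((2 * ((t * t - 1) / 3) * v%:R + 1) * j%:~R
                  + 2 * ((t * t - 1) / 3) * D%:R) by field.
rewrite tE addrK [3 * _]mulrC mulfK ?pnatr_eq0 //.
by rewrite !(rpredM, rpredD, rpred1, intr_int, natr_int).
Qed.

(* Main.v *)
Require Import Defs.
From mathcomp Require Import all_boot all_order all_algebra.
From mathcomp Require Import all_classical reals.
From mathcomp Require Import fraction zify ring.
Import Order.TTheory GRing.Theory Num.Theory.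
Local Open Scope ring_scope.

(* Applying the q-Vandermonde sum twice gives                                 *)
(*   q^(i^2/2) [2L, L-i] = sum_(r = i mod 2) K(L, r) [r, (r-i)/2],            *)
(*   K(L, r) = q^(r^2/2) [L, r] sum_m q^(m(m+r)) [L-r, m],                    *)
(* a transformation whose kernel has nonnegative coefficients. With           *)
(* i = 2^n (Delta + 2vj) it turns the polynomial G of level n into the one of *)
(* level n + 1 (the even r = 2 rho give the binomials [2 rho, rho - i/2]), so *)
(* everything reduces to level 0, the sum over j of                           *)
(* (-1)^j q^(v j^2) [t, (t-Delta)/2 - v j]. The latter is nonnegative for     *)
(* Delta < v by induction on t, using the two q-Pascal rules.                 *)

(** Signs cancel only at level 0; each higher level is a nonnegative combination of sums of the
    level below. By linearity ([nneg_transform]) the identity [qbinz_transform] passes the signs and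
    old exponents unchanged to shorter sums. For i = 2^n (Delta + 2vj) the factor q^(i^2/2) adds, up
    to a constant, 2 * 4^n * vj(vj + Delta) to the exponent; the powers of 4 add up to (4^n - 1)/3,
    the constant hidden in alpha and beta ([GexpE]). [nneg_altsum_tower] iterates this step down to
    [nneg_altsum], where Delta < v is the window condition. *)

Fixpoint qbin (n k : nat) : {poly int} :=
  match n, k with
  | _, 0%N => 1
  | 0%N, _ => 0
  | n'.+1, k'.+1 => qbin n' k' + 'X^k * qbin n' k
  end.

Definition qbinz (n : nat) (k : int) : {poly int} :=
  if k is Posz k' then qbin n k' else 0.

Definition qfactp (n : nat) : {poly int} := \prod_(1 <= j < n.+1) (1 - 'X^j).

Lemma qbinS n k : qbin n.+1 k.+1 = qbin n k + 'X^(k.+1) * qbin n k.+1.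
Proof. by []. Qed.

Lemma qbin0 n : qbin n 0 = 1. Proof. by case: n. Qed.

Lemma qbin_small n k : (n < k)%N -> qbin n k = 0.
Proof.
elim: n k => [|n IH] [|k] //= lt_nk.
by rewrite !IH ?mulr0 ?addr0 //; lia.
Qed.

Lemma qbinn n : qbin n n = 1.
Proof. by elim: n => //= n ->; rewrite qbin_small // mulr0 addr0. Qed.

Lemma qfactp0 : qfactp 0 = 1. Proof. by rewrite /qfactp big_geq. Qed.

Lemma qfactpS n : qfactp n.+1 = qfactp n * (1 - 'X^(n.+1)).
Proof. by rewrite /qfactp big_nat_recr. Qed.

Lemma qfactp_neq0 n : qfactp n != 0.
Proof.
elim: n => [|n IH]; first by rewrite qfactp0 oner_neq0.
rewrite qfactpS mulf_neq0 // subr_eq0; apply/eqP => /(congr1 (fun p : {poly int} => p`_0)).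
by rewrite coef1 coefXn.
Qed.

Lemma qbin_fact a b : qbin (a + b) a * (qfactp a * qfactp b) = qfactp (a + b).
Proof.
have [n] := ubnP (a + b)%N; elim: n a b => // n IH [|a] [|b] lt_n.
- by rewrite !qfactp0 !mulr1.
- by rewrite qbin0 qfactp0 !mul1r.
- by rewrite addn0 qbinn qfactp0 mulr1 mul1r.
rewrite addSn qbinS [qfactp (a + b.+1).+1]qfactpS.
have e1 := IH a b.+1 ltac:(lia); have e2 := IH a.+1 b ltac:(lia).
rewrite addSnnS in e2; rewrite -addSn exprD mulrDl.
(* Splits 1 - xy as (1 - x) + x(1 - y), matching the two terms of the Pascal rule. *)
transitivity (qfactp (a + b.+1) * (1 - 'X^(a.+1)) +
              'X^(a.+1) * (1 - 'X^(b.+1)) * qfactp (a + b.+1)); last by ring.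
by rewrite -{1}e1 -e2 [qfactp a.+1]qfactpS [qfactp b.+1]qfactpS; ring.
Qed.

Lemma qbin_sub n k : (k <= n)%N -> qbin n (n - k) = qbin n k.
Proof.
move=> le_kn; have e1 := qbin_fact k (n - k); have e2 := qbin_fact (n - k) k.
apply: (mulIf (mulf_neq0 (qfactp_neq0 k) (qfactp_neq0 (n - k)))).
by rewrite subnKC // subnK // in e1 e2; rewrite e1 mulrC [_ * qfactp _]mulrC mulrC e2.
Qed.

Lemma qVandermonde s n t :
  qbin (s + n) t =
    \sum_(m < t.+1) 'X^((s - m) * (t - m)) * qbin s m * qbin n (t - m).
Proof.
elim: s t => [|s IH] [|t].
- by rewrite big_ord1 !qbin0 !mulr1.
- by rewrite big_ord_recl /= big1 ?addr0 ?mul1r //= => i _; rewrite mulr0 mul0r.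
- by rewrite big_ord1 !qbin0 muln0 !mulr1.
rewrite addSn qbinS !IH [RHS]big_ord_recl [X in _ + _ * X = _]big_ord_recl.
rewrite mulrDr addrCA /= !subn0 !qbin0; congr (_ + _).
  by rewrite !mulr1 mulrA -exprD mulSn.
rewrite mulr_sumr -big_split /=; apply: eq_bigr => m _.
rewrite /bump /= !add1n !subSS.
(* For m >= s the truncated exponent is wrong, but its term vanishes. *)
have [le_ms|lt_sm] := leqP m.+1 s; last by rewrite (@qbin_small s m.+1) //; ring.
have -> : ((s - m) * (t - m) = (s - m.+1) * (t - m) + (t - m))%N.
  by rewrite -[(s - m)%N](@subnSK m s) // mulSn addnC.
have -> : 'X^(t.+1) = 'X^(t - m) * 'X^(m.+1) :> {poly int}.
  by rewrite -exprD; congr ('X^_); have := ltn_ord m; lia.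
by rewrite exprD; ring.
Qed.

(* Both sides are the q-multinomial coefficient with parts [a, b, c, d]. *)
Lemma qbin_multinomial a b c d :
  qbin (a + b + c + d) (a + b) * qbin (a + b) b * qbin (c + d) c =
  qbin (a + b + c + d) (a + c) * qbin (a + c) c * qbin (b + d) b.
Proof.
have Q := qfactp_neq0.
apply: (mulIf (mulf_neq0 (mulf_neq0 (Q a) (Q b)) (mulf_neq0 (Q c) (Q d)))).
have := qbin_fact (a + b) (c + d); have := qbin_fact b a.
have := qbin_fact c d; have := qbin_fact (a + c) (b + d).
have := qbin_fact c a; have := qbin_fact b d.
rewrite [(b + a)%N]addnC [(c + a)%N]addnC !addnA [(a + c + b)%N]addnAC.
set x1 := qbin (b + d) b; set x2 := qbin (a + c) c.
move=> e1 e2 e3 e4 e5 e6.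
transitivity (qfactp (a + b + c + d)).
  by rewrite -e6 -e5 -e4; ring.
by rewrite -e3 -e2 -e1; ring.
Qed.

(** * Nonnegative coefficients, and binomials with an integer lower index *)

Definition nneg_poly (p : {poly int}) : Prop := forall i, 0 <= p`_i.

Lemma nneg_poly0 : nneg_poly 0.
Proof. by move=> i; rewrite coef0. Qed.

Lemma nneg_polyXn n : nneg_poly 'X^n.
Proof. by move=> i; rewrite coefXn; case: (_ == _). Qed.

Lemma nneg_polyD p r : nneg_poly p -> nneg_poly r -> nneg_poly (p + r).
Proof. by move=> hp hr i; rewrite coefD addr_ge0. Qed.

Lemma nneg_polyM p r : nneg_poly p -> nneg_poly r -> nneg_poly (p * r).
Proof.
by move=> hp hr i; rewrite coefM; apply: sumr_ge0 => j _; rewrite mulr_ge0.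
Qed.

Lemma nneg_poly_sum I (s : seq I) (F : I -> {poly int}) :
  (forall i, nneg_poly (F i)) -> nneg_poly (\sum_(i <- s) F i).
Proof. by move=> hF; apply: big_ind => //; [exact: nneg_poly0|exact: nneg_polyD]. Qed.

Lemma nneg_qbin n k : nneg_poly (qbin n k).
Proof.
elim: n k => [|n IH] [|k] /=.
- exact: (nneg_polyXn 0).
- exact: nneg_poly0.
- exact: (nneg_polyXn 0).
by apply: nneg_polyD => //; apply: nneg_polyM => //; exact: nneg_polyXn.
Qed.

Lemma nneg_qbinz n k : nneg_poly (qbinz n k).
Proof. by case: k => k /=; [exact: nneg_qbin|exact: nneg_poly0]. Qed.

Lemma qbinz_out n k : k < 0 \/ n%:Z < k -> qbinz n k = 0.
Proof. by case: k => k //= []; [lia|rewrite ltz_nat => /qbin_small]. Qed.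

Lemma qbinz_sub n k : qbinz n (n%:Z - k) = qbinz n k.
Proof.
have [k0|k0] := ltP k 0; first by rewrite !qbinz_out //; lia.
have [nk|kn] := ltP n%:Z k; first by rewrite !qbinz_out //; lia.
case: k k0 kn => // k _ kn; by rewrite subzn //=; exact: qbin_sub.
Qed.

Lemma qbinzS n k : qbinz n.+1 k = qbinz n (k - 1) + 'X^`|k|%N * qbinz n k.
Proof.
case: k => [[|k]|k]; first 1 last.
- by rewrite (_ : k.+1%:Z - 1 = k) //; lia.
- by rewrite !qbinz_out ?mulr0 ?addr0 //; lia.
by rewrite sub0r /= !qbin0 add0r mulr1.
Qed.

Lemma qbinzS_sub n k :
  qbinz n.+1 k = qbinz n k + 'X^`|n.+1 - k|%N * qbinz n (k - 1).
Proof.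
rewrite -qbinz_sub qbinzS -[qbinz n k]qbinz_sub -[qbinz n (k - 1)]qbinz_sub.
by congr (qbinz _ _ + 'X^_ * qbinz _ _); lia.
Qed.

(** * The transformation with nonnegative kernel *)

Lemma big_ord_shift (V : nmodType) (F : nat -> V) b n : (b <= n)%N ->
    (forall t, (t < b)%N -> F t = 0) -> (forall t, (n <= t)%N -> F t = 0) ->
  \sum_(t < n) F t = \sum_(t < n) F (t + b)%N.
Proof.
move=> le_bn F_lt F_ge; rewrite -(big_mkord predT F) -(big_mkord predT (fun t => F (t + b)%N)).
rewrite (@big_cat_nat _ _ _ b) //= big_nat big1 ?add0r => [|t /andP[_]]; last exact: F_lt.
rewrite -{1}[b]add0n big_addn [RHS](@big_cat_nat _ _ _ (n - b)) ?leq_subr //=.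
by rewrite [X in _ = _ + X]big_nat [X in _ = _ + X]big1 ?addr0 // => t /andP[h _]; apply: F_ge; lia.
Qed.

Lemma qbin_central L i : (i <= L)%N ->
  qbin (L + L) (L - i) =
    \sum_(t < L.+1) 'X^(t * (t + i)) * qbin L t * qbin L (t + i).
Proof.
move=> le_iL; rewrite qVandermonde (reindex_inj rev_ord_inj) /=.
pose F t := 'X^(t * (t + i)) * qbin L t * qbin L (t + i).
transitivity (\sum_(t < (L - i).+1) F t).
  apply: eq_bigr => t _; rewrite /F; have := ltn_ord t => lt_t.
  rewrite subSS (_ : (L - i - (L - i - t) = t)%N); last by lia.
  rewrite (_ : (L - (L - i - t) = t + i)%N); last by lia.
  rewrite -(@qbin_sub L (t + i)); last by lia.
  rewrite (_ : (L - (t + i) = L - i - t)%N); last by lia.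
  by rewrite mulrAC mulnC.
rewrite (big_ord_widen L.+1) ?big_mkcond /=; last by lia.
by apply: eq_bigr => t _; case: ifP => // lt_t; rewrite (@qbin_small L (t + i)) ?mulr0 //; lia.
Qed.

(** At q = 1 this sorts pairs of subsets A, B of sizes t and t + i by b = |A \ B|: the symmetric
    difference has 2b + i elements, the intersection t - b. For general q, expand [L, t] by
    q-Vandermonde along L = (t + i) + (L - t - i) and regroup each term by [qbin_multinomial]. *)
Lemma qbin_mul L t i :
  qbin L t * qbin L (t + i) =
    \sum_(b < t.+1) 'X^(b * (b + i)) * qbin L (2 * b + i) *
                    qbin (2 * b + i) b * qbin (L - (2 * b + i)) (t - b).
Proof.
have [le_tiL|lt_Lti] := leqP (t + i) L; last first.
  rewrite [qbin L (t + i)]qbin_small // mulr0 big1 // => b _.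
  have [le_L|lt_L] := leqP (2 * b + i) L.
    by rewrite [qbin _ (t - b)]qbin_small ?mulr0 //; have := ltn_ord b; lia.
  by rewrite [qbin L _]qbin_small // mulr0 !mul0r.
rewrite -{1}(subnKC le_tiL) qVandermonde (reindex_inj rev_ord_inj) /= mulr_suml.
apply: eq_bigr => b _; have := ltn_ord b => lt_b; rewrite subSS.
rewrite (_ : (t - (t - b) = b)%N); last by lia.
rewrite (_ : (t + i - (t - b) = b + i)%N); last by lia.
(* If t + i + b > L both sides vanish; otherwise the fourth part of the multinomial is a genuine
   difference. *)
have [le_L|lt_L] := leqP (t + i + b) L; last first.
  rewrite [qbin (L - (t + i)) b]qbin_small; last by lia.
  have [le_L'|lt_L'] := leqP (2 * b + i) L.
    by rewrite [qbin (L - _) (t - b)]qbin_small ?mulr0 ?mul0r //; lia.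
  by rewrite [qbin L (2 * b + i)]qbin_small // !mulr0 !mul0r.
have := qbin_multinomial (b + i) b (t - b) (L - (t + i + b)).
rewrite (_ : (b + i + b + (t - b) + (L - (t + i + b)) = L)%N); last by lia.
rewrite (_ : (b + i + b = 2 * b + i)%N); last by lia.
rewrite (_ : (t - b + (L - (t + i + b)) = L - (2 * b + i))%N); last by lia.
rewrite (_ : (b + i + (t - b) = t + i)%N); last by lia.
rewrite (_ : (b + (L - (t + i + b)) = L - (t + i))%N); last by lia.
move=> e; rewrite -!mulrA [qbin L (2 * b + i) * _]mulrA e [((b + i) * b)%N]mulnC.
by ring.
Qed.

(** K(L, r) without its factor q^(r^2/2), whose exponent can be a half-integer. *)
Definition qker (L r : nat) : {poly int} :=
  qbin L r * \sum_(m < L.+1) 'X^(m * (m + r)) * qbin (L - r) m.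

Lemma nneg_qker L r : nneg_poly (qker L r).
Proof.
apply: nneg_polyM; first exact: nneg_qbin.
by apply: nneg_poly_sum => m; apply: nneg_polyM; [exact: nneg_polyXn|exact: nneg_qbin].
Qed.

(** Insert [qbin_mul] into [qbin_central], exchange the sums and put t = m + b; the exponents then
    separate into a part in b and the kernel's own. *)
Lemma qbin_transform_nat L i : (i <= L)%N ->
  qbin (L + L) (L - i) =
    \sum_(b < L.+1) 'X^(2 * (b * (b + i))) * qker L (2 * b + i) * qbin (2 * b + i) b.
Proof.
move=> le_iL; rewrite qbin_central //.
pose f t b := 'X^(t * (t + i) + b * (b + i)) * qbin L (2 * b + i) *
                    qbin (2 * b + i) b * qbin (L - (2 * b + i)) (t - b).
transitivity (\sum_(t < L.+1) \sum_(b < L.+1 | (b <= t)%N) f t b).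
  apply: eq_bigr => t _; rewrite -mulrA qbin_mul mulr_sumr.
  rewrite (big_ord_widen L.+1 (fun b => 'X^(t * (t + i)) * ('X^(b * (b + i)) * qbin L (2 * b + i) *
                    qbin (2 * b + i) b * qbin (L - (2 * b + i)) (t - b)))) //.
  by apply: eq_bigr => b _; rewrite /f exprD; ring.
rewrite (exchange_big_dep predT) //=; apply: eq_bigr => b _.
have lt_b := ltn_ord b; rewrite big_mkcond /=.
rewrite (@big_ord_shift _ (fun t => if (b <= t)%N then f t b else 0) b); first last.
- move=> t lt_Lt; case: ifP => // _; rewrite /f.
  have [le_L|lt_L] := leqP (2 * b + i) L.
    by rewrite [qbin (L - _) (t - b)]qbin_small ?mulr0 //; lia.
  by rewrite [qbin L (2 * b + i)]qbin_small // mulr0 !mul0r.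
- by move=> t lt_tb; rewrite leqNgt lt_tb.
- by lia.
rewrite /qker mulr_sumr mulr_sumr mulr_suml; apply: eq_bigr => m _.
rewrite leq_addl /f addnK.
have -> : ((m + b) * (m + b + i) + b * (b + i) =
  2 * (b * (b + i)) + m * (m + (2 * b + i)))%N by ring.
by rewrite exprD; ring.
Qed.

(** The transformation divided by q^(d^2/2): since (d + 2w)^2/2 = d^2/2 + 2w(w + d), all exponents
    become natural numbers, and one [d] serves a whole family of indices i. Terms with u < w
    vanish. *)
Lemma qbinz_transform L d w (i : int) : `|i|%N = (d + 2 * w)%N ->
  'X^(2 * (w * (w + d))) * qbinz (L + L) (L%:Z - i) =
    \sum_(u < L.+1) 'X^(2 * (u * (u + d))) * qker L (d + 2 * u) *
       qbinz (d + 2 * u) (((d + 2 * u)%N%:Z - i) %/ 2)%Z.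
Proof.
move=> ei.
(* By the symmetry of the binomials only |i| matters. *)
have -> : qbinz (L + L) (L%:Z - i) = qbinz (L + L) (L%:Z - (d + 2 * w)%N%:Z).
  have [i0|i0] := leP 0 i; first by congr qbinz; lia.
  by rewrite -qbinz_sub; congr qbinz; lia.
transitivity (\sum_(u < L.+1) 'X^(2 * (u * (u + d))) * qker L (d + 2 * u) *
       qbinz (d + 2 * u) (u%:Z - w%:Z)); last first.
  apply: eq_bigr => u _; congr (_ * _).
  have [i0|i0] := leP 0 i; first by congr qbinz; lia.
  by rewrite -qbinz_sub; congr qbinz; lia.
have [le_L|lt_L] := leqP (d + 2 * w) L; last first.
  rewrite qbinz_out ?mulr0; last by lia.
  rewrite big1 // => u _; have [lt_uw|le_wu] := ltnP u w.
    by rewrite qbinz_out ?mulr0 //; lia.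
  by rewrite /qker qbin_small ?mul0r ?mulr0 ?mul0r //; lia.
rewrite subzn //= qbin_transform_nat //.
pose g u := 'X^(2 * (u * (u + d))) * qker L (d + 2 * u) * qbinz (d + 2 * u) (u%:Z - w%:Z).
rewrite (@big_ord_shift _ g w) ?mulr_sumr; first last.
- by move=> u lt_Lu; rewrite /g /qker qbin_small ?mul0r ?mulr0 ?mul0r //; lia.
- by move=> u lt_uw; rewrite /g qbinz_out ?mulr0 //; lia.
- by lia.
apply: eq_bigr => b _; rewrite /g PoszD addrK /=.
rewrite (_ : (d + 2 * (b + w) = 2 * b + (d + 2 * w))%N); last by lia.
by rewrite mulrA mulrA -exprD; congr ('X^_ * _ * _); ring.
Qed.

Lemma nneg_transform (I : finType) (c : I -> {poly int}) (i : I -> int) (w : I -> nat) d L :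
  (forall x, `|i x|%N = (d + 2 * w x)%N) ->
  (forall u, (d + 2 * u <= L)%N ->
    nneg_poly (\sum_x c x * qbinz (d + 2 * u) (((d + 2 * u)%N%:Z - i x) %/ 2)%Z)) ->
  nneg_poly (\sum_x c x * 'X^(2 * (w x * (w x + d))) * qbinz (L + L) (L%:Z - i x)).
Proof.
move=> ei hF.
rewrite (_ : \sum_x _ = \sum_(u < L.+1) 'X^(2 * (u * (u + d))) * qker L (d + 2 * u) *
  \sum_x c x * qbinz (d + 2 * u) (((d + 2 * u)%N%:Z - i x) %/ 2)%Z); last first.
  under eq_bigr => x _ do rewrite -mulrA (qbinz_transform _ _ _ _ (ei x)) mulr_sumr.
  rewrite exchange_big; apply: eq_bigr => u _; rewrite mulr_sumr.
  by apply: eq_bigr => x _; rewrite mulrCA.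
apply: nneg_poly_sum => u; have [le_L|lt_L] := leqP (d + 2 * u) L; last first.
  rewrite /qker qbin_small // mul0r mulr0 mul0r; exact: nneg_poly0.
apply: nneg_polyM; last exact: hF.
by apply: nneg_polyM; [exact: nneg_polyXn|exact: nneg_qker].
Qed.

(** * Level 0: alternating sums under the q-Pascal rules *)

Definition csum {V : nmodType} (B : nat) (f : int -> V) : V :=
  \sum_(x < (B + B).+1) f (x%:Z - B%:Z).

Lemma csumN (V : nmodType) B (f : int -> V) : csum B f = csum B (fun j => f (- j)).
Proof.
rewrite /csum (reindex_inj rev_ord_inj) /=; apply: eq_bigr => x _; congr f.
by have := ltn_ord x; lia.
Qed.

(** The reflection j -> 1 - j preserves the window -B..B once its left end is dropped, so the rest
    equals its own opposite. *)
Lemma csum_antisym B (f : int -> {poly int}) :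
  f (- B%:Z) = 0 -> (forall j, f (1 - j) = - f j) -> csum B f = 0.
Proof.
move=> f0 fN; rewrite /csum big_ord_recl /= sub0r f0 add0r.
set S := \sum_(_ < _) _; have eS : S = - S.
  rewrite {1}/S (reindex_inj rev_ord_inj) -sumrN /=.
  apply: eq_bigr => x _; rewrite -fN; congr f.
  by rewrite /bump /=; have := ltn_ord x; lia.
apply/polyP => i; move/(congr1 (fun p : {poly int} => p`_i)): eS.
by rewrite coefN coef0; move: (S`_i) => z; lia.
Qed.

Lemma mulz_pred_ge0 (j : int) : 0 <= j * (j - 1). Proof. by nia. Qed.
Lemma mulzz_ge0 (j : int) : 0 <= j * j. Proof. by nia. Qed.

Definition altsum (B K : nat) (e : int -> nat) (t : nat) (N : int) : {poly int} :=
  csum B (fun j => (-1) ^+ `|j|%N * 'X^(e j) * qbinz t (N - K%:Z * j)).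

Lemma nneg_altsum_triv B K e t N :
    (forall j, j != 0 -> qbinz t (N - K%:Z * j) = 0) -> nneg_poly (altsum B K e t N).
Proof.
move=> h; apply: nneg_poly_sum => x; have [->|nz] := eqVneq (x%:Z - B%:Z) 0.
  rewrite mul1r; apply: nneg_polyM; [exact: nneg_polyXn|exact: nneg_qbinz].
by rewrite h // mulr0; exact: nneg_poly0.
Qed.

(* These are the exponents of G for (alpha, beta) = (1, 1) and (0, 2).        *)
Definition ex1 (K : nat) (j : int) : nat := (K * `|(j * j)%R|)%N.
Definition ex0 (K : nat) (j : int) : nat := (K * `|(j * (j - 1))%R|)%N.

Lemma altsum1_sym B K t N : altsum B K (ex1 K) t N = altsum B K (ex1 K) t (t%:Z - N).
Proof.
rewrite {1}/altsum csumN; apply: eq_bigr => x _ /=; rewrite /ex1 mulrNN abszN; congr (_ * _).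
by rewrite -qbinz_sub; congr qbinz; ring.
Qed.

(** Termwise Pascal rule: K j^2 + (N - Kj) = N + K j(j - 1) turns one exponent into the other. *)
Lemma altsum1_rec B K t N :
  altsum B K (ex1 K) t.+1 N%:Z =
    altsum B K (ex1 K) t (N%:Z - 1) + 'X^N * altsum B K (ex0 K) t N%:Z.
Proof.
rewrite /altsum /csum mulr_sumr -big_split /=; apply: eq_bigr => x _.
set j := x%:Z - _; rewrite qbinzS mulrDr; congr (_ + _).
  by congr (_ * qbinz _ _); ring.
(* The absolute value in the Pascal exponent is harmless: where it differs, the binomial is 0. *)
have [lt0|ge0] := ltP (N%:Z - K%:Z * j) 0; first by rewrite qbinz_out ?mulr0 //; left.
have e : (ex1 K j + absz (N%:Z - K%:Z * j)%R = N + ex0 K j)%N.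
  apply/eqP; rewrite -eqz_nat; apply/eqP; rewrite !PoszD !PoszM.
  by rewrite !gez0_abs ?mulz_pred_ge0 ?mulzz_ge0 //; ring.
transitivity ((-1) ^+ `|j| * 'X^(ex1 K j + absz (N%:Z - K%:Z * j)%R) * qbinz t (N%:Z - K%:Z * j)).
  by rewrite exprD; ring.
by rewrite e exprD; ring.
Qed.

(** The other Pascal rule, with K j(j - 1) + (M + Kj) = M + K j^2. *)
Lemma altsum0_rec B K t M :
  altsum B K (ex0 K) t.+1 (t.+1%:Z - M%:Z) =
    altsum B K (ex0 K) t (t.+1%:Z - M%:Z) + 'X^M * altsum B K (ex1 K) t (t%:Z - M%:Z).
Proof.
rewrite /altsum /csum mulr_sumr -big_split /=; apply: eq_bigr => x _.
set j := x%:Z - _; rewrite qbinzS_sub mulrDr; congr (_ + _).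
rewrite (_ : t.+1%:Z - M%:Z - K%:Z * j - 1 = t%:Z - M%:Z - K%:Z * j); last by lia.
have [gtt|let_] := ltP t%:Z (t%:Z - M%:Z - K%:Z * j); first by rewrite qbinz_out ?mulr0 //; right.
set b := absz (_ - (_ - _ - _))%R; have e : (ex0 K j + b = M + ex1 K j)%N.
  apply/eqP; rewrite -eqz_nat; apply/eqP; rewrite !PoszD !PoszM.
  by rewrite /b !gez0_abs ?mulz_pred_ge0 ?mulzz_ge0 //; lia.
transitivity ((-1) ^+ `|j| * 'X^(ex0 K j + b) * qbinz t (t%:Z - M%:Z - K%:Z * j)).
  by rewrite exprD; ring.
by rewrite e exprD; ring.
Qed.

(** Here t - (N - Kj) = N - K(1 - j), so j -> 1 - j preserves binomial and exponent but flips the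
    sign. *)
Lemma altsum0_end B K t N : (0 < K)%N -> (t < B)%N -> 2 * N - t%:Z = K%:Z ->
  altsum B K (ex0 K) t N = 0.
Proof.
move=> K0 ltB eN; apply: csum_antisym => [|j].
  by rewrite qbinz_out ?mulr0 //; right; nia.
rewrite /ex0 (_ : (1 - j) * (1 - j - 1) = j * (j - 1)); last by ring.
rewrite -[qbinz t (N - K%:Z * j)]qbinz_sub -!mulNr; congr (_ * _ * qbinz _ _); last by lia.
by rewrite -signr_odd -[in RHS]signr_odd (_ : odd `|1 - j| = ~~ odd `|j|); [case: (odd _); rewrite ?opprK|lia].
Qed.

(* The Pascal rules move between the two sums and change d = 2 N - t by one.  *)
(* The windows for d are preserved except at the end d = K of the second,     *)
(* where the sum is antisymmetric under j -> 1 - j and vanishes.              *)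
Lemma nneg_altsum B K t : (1 < K)%N -> (t < B)%N ->
  (forall N : int, - K%:Z < 2 * N - t%:Z < K%:Z -> nneg_poly (altsum B K (ex1 K) t N)) /\
  (forall N : int, 2 - K%:Z <= 2 * N - t%:Z <= K%:Z -> nneg_poly (altsum B K (ex0 K) t N)).
Proof.
move=> K1; elim: t => [|t IH] lt_tB.
  by split => N hN; apply: nneg_altsum_triv => j nz; apply: qbinz_out; nia.
have {IH} [IH1 IH0] := IH (ltnW lt_tB); split => N hN.
  (* The rule sends d to d - 1 in the first sum, which would leave the window at d = 1 - K; d >= 0
     also makes N a natural number. *)
  wlog ge0 : N hN / 0 <= 2 * N - t.+1%:Z.
    move=> hwlog; have [ge0|lt0] := leP 0 (2 * N - t.+1%:Z); first exact: hwlog.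
    by rewrite altsum1_sym; apply: hwlog; lia.
  case: N hN ge0 => [N|N] hN ge0; last by lia.
  rewrite altsum1_rec; apply: nneg_polyD; first by apply: IH1; lia.
  by apply: nneg_polyM; [exact: nneg_polyXn|apply: IH0; lia].
have [eK|neK] := eqVneq (2 * N - t.+1%:Z) K%:Z.
  by rewrite altsum0_end //; [exact: nneg_poly0|lia].
have [gt_N|le_N] := ltP t.+1%:Z N.
  by apply: nneg_altsum_triv => j nz; apply: qbinz_out; nia.
have [M eM] : exists M : nat, N = t.+1%:Z - M%:Z by exists `|t.+1%:Z - N|%N; lia.
rewrite eM altsum0_rec; apply: nneg_polyD; first by apply: IH0; lia.
by apply: nneg_polyM; [exact: nneg_polyXn|apply: IH1; lia].
Qed.

(** * Climbing the levels *)

Definition geo4 (n : nat) : nat := (\sum_(k < n) 4 ^ k)%N.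

Lemma geo4S n : geo4 n.+1 = (geo4 n + 4 ^ n)%N.
Proof. by rewrite /geo4 big_ord_recr. Qed.

Lemma geo4E n : (4 ^ n = 3 * geo4 n + 1)%N.
Proof.
elim: n => [|n IH]; first by rewrite /geo4 big_ord0.
by rewrite geo4S expnS IH; lia.
Qed.

(** The exponent of G at level n: that of level 0 plus the gains of n transformations. *)
Definition exG (n v D : nat) (j : int) : nat :=
  (v * `|(j * j)%R| + 2 * geo4 n * `|(v%:Z * j * (v%:Z * j + D%:Z))%R|)%N.

Lemma vjD_ge0 (v D : nat) (j : int) : (D < v)%N -> 0 <= v%:Z * j * (v%:Z * j + D%:Z).
Proof.
move=> ltDv; rewrite -mulrA mulr_ge0 //; have [j0|j0] := leP 0 j; first by nia.
by apply: mulr_le0; nia.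
Qed.

(** Half the excess of |D + 2vj| over D; for D < v the subtraction is not truncated. *)
Definition wG (v D : nat) (j : int) : nat :=
  if 0 <= j then (v * `|j|)%N else (v * `|j| - D)%N.

Lemma wG_abs p v D (j : int) : (D < v)%N ->
  `|(p%:Z * (D%:Z + 2 * v%:Z * j))%R|%N = (p * D + 2 * (p * wG v D j))%N.
Proof. by move=> ltDv; rewrite abszM /wG; case: leP => j0; nia. Qed.

Lemma wG_sqr p v D (j : int) : (D < v)%N ->
  (p * wG v D j * (p * wG v D j + p * D) =
   p ^ 2 * `|(v%:Z * j * (v%:Z * j + D%:Z))%R|)%N.
Proof.
move=> ltDv.
have -> : (`|(v%:Z * j * (v%:Z * j + D%:Z))%R| = wG v D j * (wG v D j + D))%N.
  rewrite abszM [absz (_ * _)]abszM /wG /=; case: leP => j0.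
    by congr (_ * _)%N; nia.
  by rewrite mulnC subnK; [congr (_ * _)%N; nia|nia].
by ring.
Qed.

Lemma nneg_altsum_step B n v D L : (D < v)%N ->
    (forall u, (2 ^ n * D + 2 * u <= L)%N ->
      nneg_poly (csum B (fun j => (-1) ^+ `|j|%N * 'X^(exG n v D j) *
        qbinz (2 ^ n * D + 2 * u) (u%:Z - (2 ^ n * v)%N%:Z * j)))) ->
  nneg_poly (altsum B (2 ^ n.+1 * v) (exG n.+1 v D) (L + L) (L%:Z - (2 ^ n * D)%N%:Z)).
Proof.
move=> ltDv hF; pose J (x : 'I_(B + B).+1) := x%:Z - B%:Z.
have := @nneg_transform _ (fun x => (-1) ^+ `|J x|%N * 'X^(exG n v D (J x)))
  (fun x => (2 ^ n)%N%:Z * (D%:Z + 2 * v%:Z * J x)) (fun x => (2 ^ n * wG v D (J x))%N)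
  (2 ^ n * D) L (fun x => wG_abs _ _ _ _ ltDv).
rewrite (_ : \sum_x _ = altsum B (2 ^ n.+1 * v) (exG n.+1 v D) (L + L) (L%:Z - (2 ^ n * D)%N%:Z)).
  apply=> u le_u; move: (hF u le_u); congr nneg_poly; apply: eq_bigr => x _.
  rewrite -/(J x); congr (_ * qbinz _ _).
  rewrite [X in (X %/ _)%Z](_ : _ = (u%:Z - (2 ^ n * v)%N%:Z * J x) * 2) ?mulzK //.
  by rewrite !PoszD !PoszM; ring.
apply: eq_bigr => x _; rewrite -/(J x) -[_ * _ * 'X^_]mulrA -exprD.
congr (_ * 'X^_ * qbinz _ _).
  by rewrite wG_sqr // /exG geo4S -expnM (mulnC n) expnM; ring.
by rewrite expnS !PoszM; ring.
Qed.

(** Above the bottom, r = 2^n D + 2u is twice 2^(n-1) D + u, which takes the place of [L] one level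
    down. At the bottom 2u - (D + 2u) = -D lies in the window of [nneg_altsum] for K = v. *)
Lemma nneg_altsum_tower B n v D L : (1 < v)%N -> (D < v)%N -> (L < B)%N ->
  nneg_poly (altsum B (2 ^ n.+1 * v) (exG n.+1 v D) (L + L) (L%:Z - (2 ^ n * D)%N%:Z)).
Proof.
move=> v1 ltDv; elim: n L => [|n IH] L ltLB; apply: nneg_altsum_step => // u le_u.
  rewrite expn0 !mul1n in le_u *.
  have [h _] := nneg_altsum B v (D + 2 * u) v1 (leq_ltn_trans le_u ltLB).
  have /h : - v%:Z < 2 * u%:Z - (D + 2 * u)%N%:Z < v%:Z by lia.
  congr nneg_poly; apply: eq_bigr => x _.
  by rewrite /ex1 /exG /geo4 big_ord0 muln0 mul0n addn0.
have /IH : (2 ^ n * D + u < B)%N by rewrite expnS in le_u; lia.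
congr nneg_poly; apply: eq_bigr => x _; congr (_ * qbinz _ _).
  by rewrite expnS; ring.
by rewrite PoszD; ring.
Qed.

(** * Back to G in the fraction field *)

Lemma tofrac_qfactp n : tofrac (qfactp n) = qfact n.
Proof.
rewrite /qfactp /qfact rmorph_prod; apply: eq_bigr => j _.
by rewrite rmorphB rmorph1 rmorphXn.
Qed.

Lemma tofrac_qbinz n k : tofrac (qbinz n k) = qbinom n%:Z k.
Proof.
rewrite /qbinom; case: ifPn => [/andP[k0 kn]|]; last first.
  by rewrite negb_and => h; rewrite qbinz_out ?rmorph0 //; lia.
case: k k0 kn => // k _ kn; have le_kn : (k <= n)%N by lia.
rewrite subzn //= -!tofrac_qfactp -rmorphM /=.
apply: (canRL (mulfK _)); first by rewrite tofrac_eq0 mulf_neq0 ?qfactp_neq0.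
by rewrite -rmorphM; have := qbin_fact k (n - k); rewrite subnKC // => ->.
Qed.

Lemma fsum_csum (V : nmodType) B (f : int -> V) :
  (forall j, (B < `|j|)%N -> f j = 0) -> \sum_(j \in [set: int]) f j = csum B f.
Proof.
move=> f0; pose s := [seq x%:Z - B%:Z | x <- iota 0 (B + B).+1].
have s_uniq : uniq s by rewrite map_inj_uniq ?iota_uniq // => x y; lia.
rewrite -(@fsbig_widen _ _ _ _ [set` s]%classic) //.
  rewrite -fsbig_seq // big_map /csum.
  by rewrite -(big_mkord predT (fun x => f (x%:Z - B%:Z))) /index_iota subn0.
move=> j [_ /= /negP js]; apply: f0; rewrite ltnNge; apply: contra js => jB.
by apply/mapP; exists `|(j + B%:Z)%R|%N; rewrite ?mem_iota; lia.
Qed.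

Lemma GexpE (R : realType) n v D (j : int) : (D < v)%N ->
  Gexp (2 * ((2 ^+ n - 2 ^- n) / 3) * (v%:R + D%:R) + 2 ^- n : R)
       (2 * ((2 ^+ n - 2 ^- n) / 3) * (v%:R - D%:R) + 2 ^- n : R)
       (2 ^ n * v) j = ((exG n v D j)%:Z)%:~R.
Proof.
move=> ltDv.
have : (2 ^+ n * 2 ^+ n : R) = 3 * (geo4 n)%:R + 1.
  by rewrite -exprMn (_ : 2 * 2 = 4%:R) -?natrM // -natrX geo4E natrD natrM.
have : (2 ^+ n : R) != 0 by rewrite expf_neq0 // pnatr_eq0.
rewrite /exG PoszD !PoszM !gez0_abs ?vjD_ge0 ?mulzz_ge0 //.
rewrite /Gexp natrM natrX !(rmorphD, rmorphM) /=; set t := 2 ^+ n => t0 tE.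
transitivity (v%:R * j%:~R * ((2 * ((t * t - 1) / 3) * v%:R + 1) * j%:~R
                  + 2 * ((t * t - 1) / 3) * D%:R)); first by field.
by rewrite tE addrK [3 * _]mulrC mulfK ?pnatr_eq0 // -!pmulrn; ring.
Qed.

Theorem theorem5p7 (R : realType) (n v Delta L : nat)
    (hn : (1 <= n)%N) (hv : (2 <= v)%N) (hDelta : (Delta < v)%N) :
  nonneg_coefs
    (G (L%:Z - (Delta * 2 ^ n.-1)%N%:Z)
       (L%:Z + (Delta * 2 ^ n.-1)%N%:Z)
       (2 * ((2 ^+ n - 2 ^- n) / 3) * (v%:R + Delta%:R) + 2 ^- n : R)
       (2 * ((2 ^+ n - 2 ^- n) / 3) * (v%:R - Delta%:R) + 2 ^- n : R)
       (2 ^ n * v)%N).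
Proof.
case: n hn => // n _.
exists (altsum L.+1 (2 ^ n.+1 * v) (exG n.+1 v Delta) (L + L) (L%:Z - (2 ^ n * Delta)%N%:Z)).
  rewrite /G (fsum_csum _ L.+1).
    rewrite /altsum /csum rmorph_sum; apply: eq_bigr => x _.
    rewrite /Gterm GexpE // intrKfloor; set j := x%:Z - _.
    rewrite !rmorphM /= tofrac_qbinz rmorphXn /= rmorphXn rmorphN1.
    congr (_ * _ * qbinom _ _); [|lia|lia].
    by case: (j) => k //; exact: invr_sign.
  (* For |j| > L + 1 the lower index is negative or exceeds 2L, so the window of radius L + 1 holds
     the whole support. *)
  move=> j ltj; rewrite /Gterm (_ : _ + _ = (L + L)%N%:Z); last by lia.
  rewrite -tofrac_qbinz qbinz_out ?rmorph0 ?mulr0 // expnS.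
  have : (0 < 2 ^ n)%N by rewrite expn_gt0.
  rewrite /=; move: (2 ^ n)%N => p p0.
  have [j0|j0] := leP 0 j; [left|right].
    have : j <= (2 * p * v)%N%:Z * j by rewrite ler_peMl //; nia.
    by lia.
  have k1 : - j <= - (2 * v%:Z * j) - Delta%:Z by nia.
  have : - j <= p%:Z * (- (2 * v%:Z * j) - Delta%:Z).
    apply: (le_trans k1); rewrite ler_peMl //.
    by apply: le_trans k1; lia.
  by lia.
exact: nneg_altsum_tower.
Qed.
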